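(* Let $\gamma$ be a closed unit-speed Legendrian curve in $S^3$ of length $L$, with curvature $k$. Then its Maslov index is $$\boldsymbol\mu_\gamma=\frac1{2\pi}\int_0^Lk(s)\,ds .$$ Hence the total curvature of a closed Legendrian curve is an integer. In addition, the total curvature of the Clifford projection of $\gamma$ is the rational number $\boldsymbol\mu_\gamma/\mathbf{cl}_\gamma$, where $\mathbf{cl}_\gamma$ is the Clifford index of $\gamma$.
   Context: $S^3\subset\mathbb C^2$ is the set of unit vectors for the standard Hermitian inner product $\langle\cdot,\cdot\rangle$ (linear in the first slot). A unit-speed Legendrian curve is a smooth $\gamma:\mathbb R\to S^3$ with $\langle\gamma_s,\gamma\rangle=0$, $\langle\gamma_s,\gamma_s\rangle=1$; its curvature is $k=\mathrm{Im}\langle\gamma_{ss},\gamma_s\rangle$. It is closed of length $L$ if it is periodic with minimal period $L$. Maslov index: for $\mathbf w=(w_1,w_2)^T\in S^3$ put $\mathbf w^*=(-\overline{w_2},\overline{w_1})^T$. For a closed unit-speed Legendrian $\gamma$ of length $L$ there is a unique smooth $\theta:\mathbb R/L\mathbb Z\to\mathbb R/2\pi\mathbb Z$ with $\gamma_s=e^{\mathrm i\theta}\gamma^*$; the Maslov index $\boldsymbol\mu_\gamma$ is the degree of $\theta$. Clifford map: $\pi_C:S^3\to S^2\subset\mathbb R^3$, $\pi_C(w_1,w_2)=\big(|w_1|^2-|w_2|^2,\,2\mathrm{Re}(\overline{w_1}w_2),\,2\mathrm{Im}(\overline{w_1}w_2)\big)$. The Clifford projection of $\gamma$ is the immersed curve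 $\eta=\pi_C\circ\gamma$ in $S^2$. Let $L_\eta$ be the length of the closed curve $\eta$ (over one minimal period); since $\pi_C$ doubles the speed of Legendrian curves, $2L=\mathbf{cl}_\gamma L_\eta$ for a positive integer $\mathbf{cl}_\gamma$, the Clifford index. ''Total curvature'' always means the integral of the curvature function (for $\eta$: the signed geodesic curvature in $S^2$ with respect to the oriented frame $(\eta,T,N)$, $N=\eta\times T$) with respect to arclength over one period, divided by $2\pi$. *)

(* Defs.v *)
From Stdlib Require Import Reals ZArith.
From Coquelicot Require Import Coquelicot.

Open Scope R_scope.

(** ** Real curves *)

Definition smooth (f : R -> R) : Prop :=
  forall (n : nat) (s : R), ex_derive_n f n s.

Definition minimal_period {X : Type} (f : R -> X) (L : R) : Prop :=
  0 < L /\ (forall s, f (s + L) = f s) /\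
  (forall T, 0 < T -> (forall s, f (s + T) = f s) -> L <= T).

(** ** Curves in C^2 and Legendrian curves in S^3 *)

Definition C2 : Type := (C * C)%type.

Definition herm (z w : C2) : C :=
  (fst z * Cconj (fst w) + snd z * Cconj (snd w))%C.

Definition in_S3 (w : C2) : Prop := herm w w = RtoC 1.

Definition smooth_C (f : R -> C) : Prop :=
  smooth (fun s => Re (f s)) /\ smooth (fun s => Im (f s)).

Definition smooth_C2 (g : R -> C2) : Prop :=
  smooth_C (fun s => fst (g s)) /\ smooth_C (fun s => snd (g s)).

Definition deriv_C (f : R -> C) (s : R) : C :=
  (Derive (fun t => Re (f t)) s, Derive (fun t => Im (f t)) s).

Definition deriv_C2 (g : R -> C2) (s : R) : C2 :=
  (deriv_C (fun t => fst (g t)) s, deriv_C (fun t => snd (g t)) s).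

Definition unit_speed_legendrian (g : R -> C2) : Prop :=
  smooth_C2 g /\
  forall s, in_S3 (g s) /\
            herm (deriv_C2 g s) (g s) = RtoC 0 /\
            herm (deriv_C2 g s) (deriv_C2 g s) = RtoC 1.

Definition closed_unit_speed_legendrian (g : R -> C2) (L : R) : Prop :=
  unit_speed_legendrian g /\ minimal_period g L.

Definition curvature (g : R -> C2) (s : R) : R :=
  Im (herm (deriv_C2 (deriv_C2 g) s) (deriv_C2 g s)).

Definition total_curvature (g : R -> C2) (L : R) : R :=
  RInt (curvature g) 0 L / (2 * PI).

(** ** Maps [R/LZ -> R/2piZ] and their degree

    Such a map is represented by a function [theta : R -> R], not assumed
    continuous, choosing a real representative of each value. Every notion
    below depends only on the values of [theta] modulo [2 * PI]. *)

Definition angle_eq (x y : R) : Prop :=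
  exists n : Z, x - y = 2 * PI * IZR n.

(** [R -> R/2piZ] is a local diffeomorphism, so smoothness into the quotient
    is the existence of smooth real representatives near each point. *)
Definition smooth_circle_map (L : R) (theta : R -> R) : Prop :=
  (forall s, angle_eq (theta (s + L)) (theta s)) /\
  (forall s, exists phi : R -> R,
      smooth phi /\ locally s (fun t => angle_eq (theta t) (phi t))).

Definition has_degree (L : R) (theta : R -> R) (d : Z) : Prop :=
  exists phi : R -> R,
    (forall s, continuous phi s) /\
    (forall s, angle_eq (theta s) (phi s)) /\
    (forall s, phi (s + L) = phi s + 2 * PI * IZR d).

(** ** Maslov index *)

Definition star (w : C2) : C2 := (Copp (Cconj (snd w)), Cconj (fst w)).

(** [cis t] is [exp (i t)]. *)
Definition cis (t : R) : C := (cos t, sin t).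

Definition scal_C2 (c : C) (w : C2) : C2 := (Cmult c (fst w), Cmult c (snd w)).

Definition is_maslov_index (g : R -> C2) (L : R) (mu : Z) : Prop :=
  exists theta : R -> R,
    smooth_circle_map L theta /\
    (forall s, deriv_C2 g s = scal_C2 (cis (theta s)) (star (g s))) /\
    has_degree L theta mu.

(** ** Curves in R^3 and on S^2 *)

Definition R3 : Type := (R * R * R)%type.

Definition pr1 (v : R3) : R := fst (fst v).
Definition pr2 (v : R3) : R := snd (fst v).
Definition pr3 (v : R3) : R := snd v.

Definition dot (u v : R3) : R :=
  pr1 u * pr1 v + pr2 u * pr2 v + pr3 u * pr3 v.

Definition norm3 (v : R3) : R := sqrt (dot v v).

Definition scal3 (a : R) (v : R3) : R3 := (a * pr1 v, a * pr2 v, a * pr3 v).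

Definition cross (u v : R3) : R3 :=
  (pr2 u * pr3 v - pr3 u * pr2 v,
   pr3 u * pr1 v - pr1 u * pr3 v,
   pr1 u * pr2 v - pr2 u * pr1 v).

Definition deriv3 (e : R -> R3) (s : R) : R3 :=
  (Derive (fun t => pr1 (e t)) s,
   Derive (fun t => pr2 (e t)) s,
   Derive (fun t => pr3 (e t)) s).

Definition speed (e : R -> R3) (s : R) : R := norm3 (deriv3 e s).

Definition unit_tangent (e : R -> R3) (s : R) : R3 :=
  scal3 (/ speed e s) (deriv3 e s).

Definition unit_normal (e : R -> R3) (s : R) : R3 :=
  cross (e s) (unit_tangent e s).

(** Curves are not assumed to be parametrized by arclength: the division by
    the speed turns the derivative of [T] in the parameter into its derivative
    in arclength. *)
Definition geodesic_curvature (e : R -> R3) (s : R) : R :=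
  dot (deriv3 (unit_tangent e) s) (unit_normal e s) / speed e s.

(** In the next two definitions [l] is a period of [e] in its own parameter,
    and arclength is [speed e s ds]. *)
Definition curve_length (e : R -> R3) (l : R) : R := RInt (speed e) 0 l.

Definition total_geodesic_curvature (e : R -> R3) (l : R) : R :=
  RInt (fun s => geodesic_curvature e s * speed e s) 0 l / (2 * PI).

(** ** Clifford projection and Clifford index *)

Definition clifford_map (w : C2) : R3 :=
  (Cmod (fst w) ^ 2 - Cmod (snd w) ^ 2,
   2 * Re (Cconj (fst w) * snd w)%C,
   2 * Im (Cconj (fst w) * snd w)%C).

Definition clifford_projection (g : R -> C2) (s : R) : R3 := clifford_map (g s).

Definition is_clifford_index (g : R -> C2) (L : R) (c : positive) : Prop :=
  exists l : R,
    minimal_period (clifford_projection g) l /\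
    2 * L = IZR (Zpos c) * curve_length (clifford_projection g) l.

(* Main.v *)
Require Import Defs.
From Stdlib Require Import Reals ZArith Lra Lia.
From Coquelicot Require Import Coquelicot.

(** Write [gamma = (z, w)] and put [u = z w' - w z']. The Legendrian condition
    makes [gamma'] a multiple of [gamma^*], and pairing shows that the factor is
    [u]: so [gamma' = u gamma^*] with [|u| = 1] ([deriv_C2_phase]), and an angle
    function [theta] as in the definition of the Maslov index is nothing but an
    argument of [u] ([phase_unique]). Differentiating once more gives
    [u' = i k u] ([legendrian_frenet]). Hence every primitive [phi] of the
    curvature [k] with the right initial value satisfies [exp (i phi) = u]
    ([angle_lift]), and any other continuous argument of [u] differs from [phi]
    by a constant. The Maslov index is therefore
    [(phi L - phi 0) / (2 PI)], the total curvature; it is an integer because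
    [u] is [L]-periodic.

    For the Clifford projection [eta], the structure equations give
    [eta' = 2 T] with [T] a unit vector, and [T' = k N - 2 eta] with
    [N = eta x T] ([deriv3_unit_tangent_frame_curve]). So [eta] has speed 2 and
    its geodesic curvature times its speed is [k]
    ([geodesic_curvature_clifford]): the total curvature of [eta] is also an
    increment of [phi], over one period [l] of [eta]. Since [eta] is immersed
    its positive periods are bounded away from 0, hence there is a smallest one,
    [l], and every other is a multiple of it; [L = n l], and comparing lengths
    shows that [n] is the Clifford index. Finally [k] is itself [l]-periodic,
    being determined by [eta], so the increment of [phi] over [L] is [n] times
    its increment over [l]. *)

(** * Smooth functions and primitives *)

Lemma smooth_ex_derive (f : R -> R) s : smooth f -> ex_derive f s.
Proof. intros Hf. exact (Hf 1%nat s). Qed.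

Lemma smooth_is_derive (f : R -> R) s : smooth f -> is_derive f s (Derive f s).
Proof. intros Hf. apply Derive_correct. exact (Hf 1%nat s). Qed.

Lemma smooth_continuous (f : R -> R) s : smooth f -> continuous f s.
Proof.
  intros Hf. apply (ex_derive_continuous (K := R_AbsRing) (V := R_NormedModule)).
  exact (Hf 1%nat s).
Qed.

Lemma Derive_n_Derive f n s : Derive_n (Derive f) n s = Derive_n f (S n) s.
Proof.
  rewrite (Derive_n_comp f n 1). f_equal. lia.
Qed.

Lemma ex_derive_n_Derive f n s :
  ex_derive_n (Derive f) (S n) s <-> ex_derive_n f (S (S n)) s.
Proof.
  split; apply ex_derive_ext; intros t; now rewrite Derive_n_Derive.
Qed.

Lemma smooth_Derive (f : R -> R) : smooth f -> smooth (Derive f).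
Proof.
  intros Hf [|n] s; [exact I|]. apply (proj2 (ex_derive_n_Derive f n s)), Hf.
Qed.

Lemma smooth_of_Derive (f : R -> R) :
  (forall s, ex_derive f s) -> smooth (Derive f) -> smooth f.
Proof.
  intros H0 H1 [|[|n]] s; [exact I | apply H0 |].
  apply (proj1 (ex_derive_n_Derive f n s)), H1.
Qed.

Lemma smooth_ext (f g : R -> R) : (forall s, f s = g s) -> smooth f -> smooth g.
Proof. intros E Hf n s. now apply (ex_derive_n_ext f). Qed.

Lemma smooth_plus (f g : R -> R) : smooth f -> smooth g -> smooth (fun s => f s + g s).
Proof.
  intros Hf Hg n s.
  apply ex_derive_n_plus; apply filter_forall; intros; [apply Hf | apply Hg].
Qed.

Lemma smooth_minus (f g : R -> R) : smooth f -> smooth g -> smooth (fun s => f s - g s).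
Proof.
  intros Hf Hg n s.
  apply ex_derive_n_minus; apply filter_forall; intros; [apply Hf | apply Hg].
Qed.

(** Leibniz' rule lowers the order by one but doubles the number of products,
    hence the strong induction over all pairs of smooth functions at once. *)
Lemma smooth_mult (f g : R -> R) : smooth f -> smooth g -> smooth (fun s => f s * g s).
Proof.
  intros Hf Hg n. revert f g Hf Hg.
  induction n as [n IH] using lt_wf_ind; intros f g Hf Hg s.
  destruct n as [|[|n]]; [exact I | |].
  - apply ex_derive_mult; now apply smooth_ex_derive.
  - apply (proj1 (ex_derive_n_Derive (fun t => f t * g t) n s)).
    apply ex_derive_n_ext with (fun t => Derive f t * g t + f t * Derive g t).
    + intros t. symmetry. apply Derive_mult; now apply smooth_ex_derive.
    + apply ex_derive_n_plus; apply filter_forall; intros y k Hk;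
        apply IH; auto using smooth_Derive; lia.
Qed.

(** [Derive] is a limit of difference quotients, and the quotients at [s] and
    at [s + l] coincide. *)
Lemma Derive_periodic (f : R -> R) l s :
  (forall t, f (t + l) = f t) -> Derive f (s + l) = Derive f s.
Proof.
  intros Hf. unfold Derive. f_equal. apply Lim_ext. intros h.
  replace (s + l + h) with (s + h + l) by ring. now rewrite !Hf.
Qed.

Lemma derivative_zero_constant (f : R -> R) x y :
  (forall s, is_derive f s 0) -> f x = f y.
Proof.
  intros Hf. destruct (Rtotal_order x y) as [H|[->|H]]; [|reflexivity|symmetry];
    now apply (eq_is_derive (V := R_NormedModule)); [intros; apply Hf|].
Qed.

Lemma primitive_exists (k : R -> R) c :
  (forall s, continuous k s) ->
  exists phi : R -> R, phi 0 = c /\ forall s, is_derive phi s (k s).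
Proof.
  intros Hk. exists (fun s => c + RInt k 0 s). split.
  - rewrite RInt_point. apply Rplus_0_r.
  - intros s. replace (k s) with (0 + k s) by ring.
    apply (is_derive_plus (K := R_AbsRing) (V := R_NormedModule)
             (fun _ => c) (fun t => RInt k 0 t) s 0 (k s)).
    { apply (is_derive_const (K := R_AbsRing) (V := R_NormedModule)). }
    apply (is_derive_RInt (V := R_NormedModule) k _ 0); [|apply Hk].
    apply filter_forall. intros b. apply (RInt_correct (V := R_CompleteNormedModule)).
    apply (ex_RInt_continuous (V := R_CompleteNormedModule)). intros; apply Hk.
Qed.

Lemma RInt_primitive (phi k : R -> R) a b :
  (forall s, continuous k s) -> (forall s, is_derive phi s (k s)) ->
  RInt k a b = phi b - phi a.
Proof.
  intros Hk Hphi. apply is_RInt_unique.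
  apply (is_RInt_derive (V := R_CompleteNormedModule)); intros; [apply Hphi | apply Hk].
Qed.

(** The difference of [phi] and its translate has derivative zero. Integrals of a
    periodic function over periods are handled through the increments of a
    primitive, which makes additivity over consecutive periods immediate. *)
Lemma primitive_shift (phi k : R -> R) l s :
  (forall t, is_derive phi t (k t)) -> (forall t, k (t + l) = k t) ->
  phi (s + l) = phi s + (phi l - phi 0).
Proof.
  intros Hphi Hk.
  assert (E : phi (s + l) - phi s = phi (0 + l) - phi 0).
  { apply (derivative_zero_constant (fun t => phi (t + l) - phi t)). intros t.
    auto_derive.
    - repeat split; eexists; apply Hphi.
    - rewrite (is_derive_unique (fun x : R => phi x) _ _ (Hphi t)),
        (is_derive_unique (fun x : R => phi x) _ _ (Hphi (t + l))), Hk. ring. }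
  rewrite Rplus_0_l in E. lra.
Qed.

Lemma primitive_shift_multiple (phi k : R -> R) l (n : positive) :
  (forall t, is_derive phi t (k t)) -> (forall t, k (t + l) = k t) ->
  phi (IZR (Zpos n) * l) - phi 0 = IZR (Zpos n) * (phi l - phi 0).
Proof.
  intros Hphi Hk. induction n as [|n IH] using Pos.peano_ind.
  - rewrite !Rmult_1_l. reflexivity.
  - rewrite Pos2Z.inj_succ, succ_IZR, Rmult_plus_distr_r, Rmult_1_l.
    rewrite (primitive_shift phi k) by assumption. lra.
Qed.

(** Otherwise the intermediate value theorem would give a value at distance 1/2
    above the smaller of the two integers. *)
Lemma integer_valued_constant (f : R -> R) x y :
  (forall s, continuous f s) -> (forall s, exists n : Z, f s = IZR n) ->
  f x = f y.
Proof.
  intros Hc Hz.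
  assert (Cf : continuity f).
  { intros s. apply continuity_pt_filterlim, Hc. }
  destruct (Hz x) as [n Hn], (Hz y) as [m Hm].
  assert (D : forall v, Rmin (f x) (f y) <= v <= Rmax (f x) (f y) ->
                exists j : Z, v = IZR j).
  { intros v Hv. destruct (IVT_gen f x y v Cf Hv) as [t [_ <-]]. apply Hz. }
  destruct (Rtotal_order (f x) (f y)) as [H|[H|H]]; [|exact H|].
  - rewrite Rmin_left, Rmax_right in D by lra.
    assert (n < m)%Z by (apply lt_IZR; lra).
    assert (IZR n + 1 <= IZR m) by (rewrite <- plus_IZR; apply IZR_le; lia).
    destruct (D (IZR n + / 2)) as [j Hj]; [lra|].
    assert (n < j)%Z by (apply lt_IZR; lra).
    assert (j < n + 1)%Z by (apply lt_IZR; rewrite plus_IZR; lra). lia.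
  - rewrite Rmin_right, Rmax_left in D by lra.
    assert (m < n)%Z by (apply lt_IZR; lra).
    assert (IZR m + 1 <= IZR n) by (rewrite <- plus_IZR; apply IZR_le; lia).
    destruct (D (IZR m + / 2)) as [j Hj]; [lra|].
    assert (m < j)%Z by (apply lt_IZR; lra).
    assert (j < m + 1)%Z by (apply lt_IZR; rewrite plus_IZR; lra). lia.
Qed.

(** * Periods *)

(** The infimum of the positive periods is attained without any continuity of
    [e]: if not, it could be approached by two distinct periods less than [delta]
    apart, whose difference would be a positive period below the bound. *)
Lemma minimal_period_exists {X : Type} (e : R -> X) L delta :
  0 < L -> (forall s, e (s + L) = e s) -> 0 < delta ->
  (forall T, 0 < T -> (forall s, e (s + T) = e s) -> delta <= T) ->
  exists l, minimal_period e l.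
Proof.
  intros HL PL Hd Hlow.
  (* Completeness provides suprema, so [E] consists of the opposites of the
     positive periods and its supremum [m] is minus their infimum. *)
  set (E := fun t => 0 < - t /\ forall s, e (s + - t) = e s).
  destruct (completeness E) as [m [Hub Hlub]].
  - exists 0. intros t [Ht _]. lra.
  - exists (- L). unfold E. rewrite Ropp_involutive. now split.
  - assert (near : forall eps, 0 < eps ->
              exists T, 0 < T /\ (forall s, e (s + T) = e s) /\ T < - m + eps).
    { intros eps Heps.
      destruct (Classical_Prop.classic
        (exists T, 0 < T /\ (forall s, e (s + T) = e s) /\ T < - m + eps))
        as [|N]; [assumption|exfalso].
      assert (m <= m - eps); [|lra]. apply Hlub. intros t [Ht Pt].
      destruct (Rle_or_lt t (m - eps)) as [|H]; [assumption|].
      exfalso. apply N. exists (- t). repeat split; auto. lra. }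
    assert (lower : forall T, 0 < T -> (forall s, e (s + T) = e s) -> - m <= T).
    { intros T HT PT. assert (- T <= m); [|lra].
      apply Hub. unfold E. rewrite Ropp_involutive. now split. }
    destruct (near delta Hd) as [T1 [H1 [P1 B1]]].
    destruct (Rle_lt_dec T1 (- m)) as [H|H].
    { exists T1. repeat split; auto. intros T HT PT.
      apply Rle_trans with (- m); auto. }
    destruct (near (T1 - - m)) as [T2 [H2 [P2 B2]]]; [lra|].
    specialize (lower T2 H2 P2).
    assert (delta <= T1 - T2); [|lra].
    apply Hlow; [lra|]. intros s.
    rewrite <- (P2 (s + (T1 - T2))).
    replace (s + (T1 - T2) + T2) with (s + T1) by ring. apply P1.
Qed.

Lemma minimal_period_unique {X : Type} (e : R -> X) l l' :
  minimal_period e l -> minimal_period e l' -> l = l'.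
Proof.
  intros [H [P M]] [H' [P' M']]. apply Rle_antisym; auto.
Qed.

(** Division of [L] by [l]: the remainder would be a smaller positive period. *)
Lemma period_multiple {X : Type} (e : R -> X) l L :
  minimal_period e l -> 0 < L -> (forall s, e (s + L) = e s) ->
  exists n : positive, L = IZR (Zpos n) * l.
Proof.
  intros [Hl [Pl Ml]] HL PL.
  assert (PN : forall (n : nat) s, e (s - INR n * l) = e s).
  { induction n as [|n IH]; intros s.
    - simpl. f_equal. ring.
    - rewrite S_INR, <- (IH s), <- (Pl (s - (INR n + 1) * l)). f_equal. ring. }
  destruct (nfloor_ex (L / l)) as [n [Hn1 Hn2]].
  { apply Rlt_le, Rdiv_lt_0_compat; assumption. }
  assert (B1 : INR n * l <= L).
  { apply Rmult_le_reg_r with (/ l); [now apply Rinv_0_lt_compat|].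
    replace (INR n * l * / l) with (INR n) by (field; lra). exact Hn1. }
  assert (B2 : L < (INR n + 1) * l).
  { apply Rmult_lt_reg_r with (/ l); [now apply Rinv_0_lt_compat|].
    replace ((INR n + 1) * l * / l) with (INR n + 1) by (field; lra). exact Hn2. }
  assert (E : L = INR n * l).
  { apply Rle_antisym; [|assumption]. apply Rnot_lt_le. intros H.
    assert (l <= L - INR n * l); [|lra].
    apply Ml; [lra|]. intros s.
    replace (s + (L - INR n * l)) with ((s + L) - INR n * l) by ring.
    now rewrite PN. }
  destruct n as [|n]; [simpl in E; lra|].
  exists (Pos.of_succ_nat n). rewrite E, INR_IZR_INZ. reflexivity.
Qed.

(** Along a sequence of periods tending to 0 the difference quotients of [f] at 0
    vanish, so its derivative there would be 0. *)
Lemma periods_bounded_below (f : R -> R) d :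
  is_derive f 0 d -> d <> 0 ->
  exists delta, 0 < delta /\
    forall T, 0 < T -> (forall s, f (s + T) = f s) -> delta <= T.
Proof.
  intros Hf Hd. apply is_derive_Reals in Hf.
  destruct (Hf (Rabs d)) as [delta Hdelta]; [now apply Rabs_pos_lt|].
  exists delta. split; [apply cond_pos|]. intros T HT PT.
  apply Rnot_lt_le. intros Hlt.
  specialize (Hdelta T). rewrite PT in Hdelta.
  replace ((f 0 - f 0) / T - d) with (- d) in Hdelta by (field; lra).
  rewrite Rabs_Ropp in Hdelta.
  apply (Rlt_irrefl (Rabs d)), Hdelta; [lra|]. rewrite Rabs_pos_eq; lra.
Qed.

(** * Angles *)

Lemma cis_eq_angle_eq x y : cis x = cis y -> angle_eq x y.
Proof.
  intros H. injection H as Hc Hs.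
  assert (H1 : cos (x - y) = 1).
  { rewrite cos_minus, Hc, Hs. generalize (sin2_cos2 y). unfold Rsqr. lra. }
  assert (H2 : sin ((x - y) / 2) = 0).
  { replace (x - y) with (2 * ((x - y) / 2)) in H1 by field.
    rewrite cos_2a_sin in H1.
    apply Rsqr_0_uniq. unfold Rsqr. lra. }
  destruct (sin_eq_0_0 _ H2) as [n Hn]. exists n. lra.
Qed.

Lemma angle_eq_cis_eq x y : angle_eq x y -> cis x = cis y.
Proof.
  intros [n Hn]. unfold cis. replace x with (y + 2 * PI * IZR n) by lra.
  assert (P : forall m : nat, forall z, cis (z + 2 * PI * INR m) = cis z).
  { intros m z. unfold cis. replace (2 * PI * INR m) with (2 * INR m * PI) by ring.
    now rewrite cos_period, sin_period. }
  fold (cis (y + 2 * PI * IZR n)) (cis y).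
  destruct (Z_le_dec 0 n) as [Hz|Hz].
  - rewrite <- (Z2Nat.id n), <- INR_IZR_INZ by assumption. apply P.
  - rewrite <- (P (Z.to_nat (- n)) (y + _)), INR_IZR_INZ, Z2Nat.id, opp_IZR by lia.
    f_equal. ring.
Qed.

Lemma cis_surjective p q : p * p + q * q = 1 -> exists x, cis x = (p, q).
Proof.
  intros H.
  assert (Hp : -1 <= p <= 1) by nra.
  unfold cis. destruct (Rle_lt_dec 0 q) as [Hq|Hq].
  - exists (acos p). rewrite cos_acos, sin_acos by assumption. f_equal.
    replace (1 - p²) with (q * q) by (unfold Rsqr; lra). now apply sqrt_square.
  - exists (- acos p). rewrite cos_neg, sin_neg, cos_acos, sin_acos by assumption.
    f_equal. replace (1 - p²) with ((- q) * (- q)) by (unfold Rsqr; lra).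
    rewrite sqrt_square; lra.
Qed.

(** The difference of two continuous arguments, divided by [2 * PI], is continuous
    with integer values. *)
Lemma continuous_angle_unique (phi psi : R -> R) s t :
  (forall x, continuous phi x) -> (forall x, continuous psi x) ->
  (forall x, angle_eq (psi x) (phi x)) ->
  psi s - phi s = psi t - phi t.
Proof.
  intros Hphi Hpsi Ha.
  assert (P := PI_RGT_0).
  assert (E : (psi s - phi s) * / (2 * PI) = (psi t - phi t) * / (2 * PI)).
  { apply (integer_valued_constant (fun x => (psi x - phi x) * / (2 * PI))).
    - intros x. apply (continuous_mult (K := R_AbsRing)); [|apply continuous_const].
      now apply (continuous_minus (V := R_NormedModule)).
    - intros x. destruct (Ha x) as [n Hn]. exists n. rewrite Hn. field. lra. }
  apply Rmult_eq_reg_r in E; [assumption|]. apply Rinv_neq_0_compat. lra.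
Qed.

(** A solution [u = p + i q] of [u' = i k u] on the unit circle lifts to the
    primitive of [k] that starts at an argument of [u 0]: for this [phi] the
    product of [u] with the conjugate of [cis phi] is constant. *)
Lemma angle_lift (p q k : R -> R) :
  (forall s, p s * p s + q s * q s = 1) ->
  (forall s, is_derive p s (- k s * q s)) ->
  (forall s, is_derive q s (k s * p s)) ->
  (forall s, continuous k s) ->
  exists phi : R -> R,
    (forall s, is_derive phi s (k s)) /\ (forall s, cis (phi s) = (p s, q s)).
Proof.
  intros H1 Hp Hq Hk.
  destruct (cis_surjective (p 0) (q 0) (H1 0)) as [c Hc].
  destruct (primitive_exists k c Hk) as [phi [H0 Hphi]].
  exists phi. split; [assumption|]. intros s.
  injection Hc as Hc1 Hc2.
  (* [A] and [B] are the real and imaginary parts of the constancy of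
     [u * Cconj (cis phi)]. *)
  assert (A : p s * cos (phi s) + q s * sin (phi s)
              = p 0 * cos (phi 0) + q 0 * sin (phi 0)).
  { apply (derivative_zero_constant
             (fun t => p t * cos (phi t) + q t * sin (phi t))).
    intros t. auto_derive.
    - repeat split; eexists; eauto.
    - rewrite (is_derive_unique (fun x : R => p x) _ _ (Hp t)),
        (is_derive_unique (fun x : R => q x) _ _ (Hq t)),
        (is_derive_unique (fun x : R => phi x) _ _ (Hphi t)). ring. }
  assert (B : q s * cos (phi s) - p s * sin (phi s)
              = q 0 * cos (phi 0) - p 0 * sin (phi 0)).
  { apply (derivative_zero_constant
             (fun t => q t * cos (phi t) - p t * sin (phi t))).
    intros t. auto_derive.
    - repeat split; eexists; eauto.
    - rewrite (is_derive_unique (fun x : R => p x) _ _ (Hp t)),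
        (is_derive_unique (fun x : R => q x) _ _ (Hq t)),
        (is_derive_unique (fun x : R => phi x) _ _ (Hphi t)). ring. }
  rewrite H0, Hc1, Hc2 in A, B.
  rewrite (H1 0) in A. replace (q 0 * p 0 - p 0 * q 0) with 0 in B by ring.
  specialize (H1 s). unfold cis. f_equal.
  - transitivity (p s * (p s * cos (phi s) + q s * sin (phi s))
                  + q s * (q s * cos (phi s) - p s * sin (phi s)));
      [|rewrite A, B; ring].
    transitivity ((p s * p s + q s * q s) * cos (phi s)); [rewrite H1|]; ring.
  - transitivity (q s * (p s * cos (phi s) + q s * sin (phi s))
                  - p s * (q s * cos (phi s) - p s * sin (phi s)));
      [|rewrite A, B; ring].
    transitivity ((p s * p s + q s * q s) * sin (phi s)); [rewrite H1|]; ring.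
Qed.

(** * Structure equations of a Legendrian curve *)

(** [auto_derive] leaves derivatives of eta-expanded functions, which [ring] and
    [rewrite] do not identify with those of the functions themselves. *)
Ltac eta_Derive f s :=
  change (Derive (fun x : R => f x) s) with (Derive f s).

(** The equations [z' = - u * Cconj w], [w' = u * Cconj z], [u' = i k u] for
    [z = a + i b], [w = c + i d], [u = p + i q], with [(z, w)] and [u] of norm 1.
    Real coordinates let [auto_derive] and [ring] do the computations. *)
Record frenet_system (a b c d p q k : R -> R) : Prop := {
  frenet_unit : forall s, a s * a s + b s * b s + c s * c s + d s * d s = 1;
  frenet_phase : forall s, p s * p s + q s * q s = 1;
  frenet_a : forall s, is_derive a s (- (p s * c s + q s * d s));
  frenet_b : forall s, is_derive b s (p s * d s - q s * c s);
  frenet_c : forall s, is_derive c s (p s * a s + q s * b s);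
  frenet_d : forall s, is_derive d s (q s * a s - p s * b s);
  frenet_p : forall s, is_derive p s (- k s * q s);
  frenet_q : forall s, is_derive q s (k s * p s)
}.

Definition re1 (g : R -> C2) (s : R) : R := Re (fst (g s)).
Definition im1 (g : R -> C2) (s : R) : R := Im (fst (g s)).
Definition re2 (g : R -> C2) (s : R) : R := Re (snd (g s)).
Definition im2 (g : R -> C2) (s : R) : R := Im (snd (g s)).

(** The Hermitian product of [gamma'] with [gamma^*]; for a Legendrian curve it is
    the unit complex number [u] with [gamma' = u gamma^*]. *)
Definition phase (g : R -> C2) (s : R) : C :=
  (fst (g s) * snd (deriv_C2 g s) - snd (g s) * fst (deriv_C2 g s))%C.

Lemma phase_re_eq g s :
  Re (phase g s) = re1 g s * Derive (re2 g) s - im1 g s * Derive (im2 g) s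
                   - (re2 g s * Derive (re1 g) s - im2 g s * Derive (im1 g) s).
Proof. reflexivity. Qed.

Lemma phase_im_eq g s :
  Im (phase g s) = re1 g s * Derive (im2 g) s + im1 g s * Derive (re2 g) s
                   - (re2 g s * Derive (im1 g) s + im2 g s * Derive (re1 g) s).
Proof. reflexivity. Qed.

Lemma curvature_eq g s :
  curvature g s
  = Derive (Derive (im1 g)) s * Derive (re1 g) s
    - Derive (Derive (re1 g)) s * Derive (im1 g) s
    + (Derive (Derive (im2 g)) s * Derive (re2 g) s
       - Derive (Derive (re2 g)) s * Derive (im2 g) s).
Proof.
  unfold curvature, herm, Im, Cplus, Cmult, Cconj, deriv_C2, deriv_C; simpl.
  change (fun t => Derive (fun t0 => Re (fst (g t0))) t) with (Derive (re1 g)).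
  change (fun t => Derive (fun t0 => Im (fst (g t0))) t) with (Derive (im1 g)).
  change (fun t => Derive (fun t0 => Re (snd (g t0))) t) with (Derive (re2 g)).
  change (fun t => Derive (fun t0 => Im (snd (g t0))) t) with (Derive (im2 g)).
  change (fun t => Re (fst (g t))) with (re1 g).
  change (fun t => Im (fst (g t))) with (im1 g).
  change (fun t => Re (snd (g t))) with (re2 g).
  change (fun t => Im (snd (g t))) with (im2 g).
  ring.
Qed.

Lemma smooth_coordinates g : unit_speed_legendrian g ->
  smooth (re1 g) /\ smooth (im1 g) /\ smooth (re2 g) /\ smooth (im2 g).
Proof. intros [[[? ?] [? ?]] _]. now repeat split. Qed.

Lemma smooth_curvature g : unit_speed_legendrian g -> smooth (curvature g).
Proof.
  intros Hg. destruct (smooth_coordinates g Hg) as (Ha & Hb & Hc & Hd).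
  eapply smooth_ext; [intros s; symmetry; apply curvature_eq|].
  apply smooth_plus; apply smooth_minus; apply smooth_mult;
    auto using smooth_Derive.
Qed.

(** The four conditions are [|gamma| = 1], the real and imaginary parts of
    [<gamma', gamma> = 0], and [|gamma'| = 1]. *)
Lemma legendrian_equations g s : unit_speed_legendrian g ->
  let a := re1 g s in let b := im1 g s in let c := re2 g s in let d := im2 g s in
  let a' := Derive (re1 g) s in let b' := Derive (im1 g) s in
  let c' := Derive (re2 g) s in let d' := Derive (im2 g) s in
  a * a + b * b + c * c + d * d = 1 /\
  a' * a + b' * b + c' * c + d' * d = 0 /\
  b' * a - a' * b + d' * c - c' * d = 0 /\
  a' * a' + b' * b' + c' * c' + d' * d' = 1.
Proof.
  intros [_ H] a b c d a' b' c' d'. destruct (H s) as (H1 & H2 & H3).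
  apply (f_equal Re) in H1. pose proof (f_equal Im H2) as H4.
  apply (f_equal Re) in H2. apply (f_equal Re) in H3.
  unfold herm, RtoC, Re, Im, Cplus, Cmult, Cconj in H1, H2, H3, H4;
    simpl in H1, H2, H3, H4.
  change (Derive (fun t => fst (fst (g t))) s) with a' in *.
  change (Derive (fun t => snd (fst (g t))) s) with b' in *.
  change (Derive (fun t => fst (snd (g t))) s) with c' in *.
  change (Derive (fun t => snd (snd (g t))) s) with d' in *.
  change (Derive (fun t => Re (fst (g t))) s) with a' in *.
  change (Derive (fun t => Im (fst (g t))) s) with b' in *.
  change (Derive (fun t => Re (snd (g t))) s) with c' in *.
  change (Derive (fun t => Im (snd (g t))) s) with d' in *.
  change (fst (fst (g s))) with a in *. change (snd (fst (g s))) with b in *.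
  change (fst (snd (g s))) with c in *. change (snd (snd (g s))) with d in *.
  repeat split; lra.
Qed.

(** [gamma] and [gamma^*] form a unitary basis of C^2 and [gamma'] is
    orthogonal to [gamma], so [gamma'] is [phase g s] times [gamma^*]. Each
    derivative formula is checked after multiplication by [|gamma|^2 = 1], where
    it becomes a combination of the two parts of [<gamma', gamma> = 0]; the norm
    of the phase comes from Lagrange's identity for
    [|gamma|^2 |gamma'|^2]. *)
Lemma legendrian_structure g s : unit_speed_legendrian g ->
  let p := Re (phase g s) in let q := Im (phase g s) in
  Derive (re1 g) s = - (p * re2 g s + q * im2 g s) /\
  Derive (im1 g) s = p * im2 g s - q * re2 g s /\
  Derive (re2 g) s = p * re1 g s + q * im1 g s /\
  Derive (im2 g) s = q * re1 g s - p * im1 g s /\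
  p * p + q * q = 1.
Proof.
  intros Hg. destruct (legendrian_equations g s Hg) as (H1 & H2 & H3 & H4).
  cbv zeta in *. rewrite phase_re_eq, phase_im_eq.
  revert H1 H2 H3 H4.
  generalize (re1 g s) (im1 g s) (re2 g s) (im2 g s) (Derive (re1 g) s)
    (Derive (im1 g) s) (Derive (re2 g) s) (Derive (im2 g) s).
  intros a b c d a' b' c' d' H1 H2 H3 H4.
  repeat split.
  - transitivity (a' * (a * a + b * b + c * c + d * d)); [rewrite H1; ring|].
    apply Rminus_diag_uniq.
    transitivity (a * (a' * a + b' * b + c' * c + d' * d)
                  - b * (b' * a - a' * b + d' * c - c' * d)); [ring|].
    rewrite H2, H3. ring.
  - transitivity (b' * (a * a + b * b + c * c + d * d)); [rewrite H1; ring|].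
    apply Rminus_diag_uniq.
    transitivity (b * (a' * a + b' * b + c' * c + d' * d)
                  + a * (b' * a - a' * b + d' * c - c' * d)); [ring|].
    rewrite H2, H3. ring.
  - transitivity (c' * (a * a + b * b + c * c + d * d)); [rewrite H1; ring|].
    apply Rminus_diag_uniq.
    transitivity (c * (a' * a + b' * b + c' * c + d' * d)
                  - d * (b' * a - a' * b + d' * c - c' * d)); [ring|].
    rewrite H2, H3. ring.
  - transitivity (d' * (a * a + b * b + c * c + d * d)); [rewrite H1; ring|].
    apply Rminus_diag_uniq.
    transitivity (d * (a' * a + b' * b + c' * c + d' * d)
                  + c * (b' * a - a' * b + d' * c - c' * d)); [ring|].
    rewrite H2, H3. ring.
  - transitivity ((a * a + b * b + c * c + d * d)
                  * (a' * a' + b' * b' + c' * c' + d' * d')); [|rewrite H1, H4; ring].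
    apply Rminus_diag_uniq.
    transitivity (- ((a' * a + b' * b + c' * c + d' * d)
                     * (a' * a + b' * b + c' * c + d' * d))
                  - (b' * a - a' * b + d' * c - c' * d)
                    * (b' * a - a' * b + d' * c - c' * d)); [ring|].
    rewrite H2, H3. ring.
Qed.

Lemma deriv_C2_phase g s : unit_speed_legendrian g ->
  deriv_C2 g s = scal_C2 (phase g s) (star (g s)).
Proof.
  intros Hg. destruct (legendrian_structure g s Hg) as (Ha & Hb & Hc & Hd & _).
  change (deriv_C2 g s) with ((Derive (re1 g) s, Derive (im1 g) s),
                              (Derive (re2 g) s, Derive (im2 g) s)).
  rewrite Ha, Hb, Hc, Hd. clear. unfold re1, im1, re2, im2.
  destruct (phase g s) as [p q], (g s) as [[a b] [c d]].
  unfold scal_C2, star, Cmult, Cconj, Copp; simpl.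
  apply injective_projections; apply injective_projections; simpl; ring.
Qed.

(** [gamma^*] is a unit vector, so the factor [u] is recovered by pairing. *)
Lemma phase_unique g s u : unit_speed_legendrian g ->
  deriv_C2 g s = scal_C2 u (star (g s)) -> phase g s = u.
Proof.
  intros Hg E. destruct (legendrian_equations g s Hg) as (H1 & _).
  cbv zeta in H1. unfold re1, im1, re2, im2, Re, Im in H1.
  unfold phase. rewrite E. revert H1.
  destruct (g s) as [[a b] [c d]], u as [p q].
  unfold scal_C2, star, Cminus, Cplus, Cmult, Cconj, Copp; simpl. intros H1.
  apply injective_projections; simpl.
  - transitivity (p * (a * a + b * b + c * c + d * d)); [ring | rewrite H1; ring].
  - transitivity (q * (a * a + b * b + c * c + d * d)); [ring | rewrite H1; ring].
Qed.

(** In the derivative of [u = z w' - w z'] the terms [z' w'] cancel, so that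
    [Im (u' * Cconj u)] is [Im <gamma'', gamma'>], the curvature [k]. As [|u| = 1],
    [u'] is orthogonal to [u], whence [u' = i k u]. *)
Lemma legendrian_frenet g : unit_speed_legendrian g ->
  frenet_system (re1 g) (im1 g) (re2 g) (im2 g)
    (fun s => Re (phase g s)) (fun s => Im (phase g s)) (curvature g).
Proof.
  intros Hg. destruct (smooth_coordinates g Hg) as (Sa & Sb & Sc & Sd).
  pose proof (fun s => legendrian_structure g s Hg) as St. cbv zeta in St.
  set (p := fun s => Re (phase g s)). set (q := fun s => Im (phase g s)).
  assert (Unit : forall s, p s * p s + q s * q s = 1) by (intros s; apply St).
  assert (Sp : smooth p).
  { apply (smooth_ext _ p (fun s => eq_sym (phase_re_eq g s))).
    auto 10 using smooth_minus, smooth_mult, smooth_Derive. }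
  assert (Sq : smooth q).
  { apply (smooth_ext _ q (fun s => eq_sym (phase_im_eq g s))).
    auto 10 using smooth_minus, smooth_plus, smooth_mult, smooth_Derive. }
  assert (Dp : forall s, Derive p s
     = re1 g s * Derive (Derive (re2 g)) s - im1 g s * Derive (Derive (im2 g)) s
       - (re2 g s * Derive (Derive (re1 g)) s - im2 g s * Derive (Derive (im1 g)) s)).
  { intros s. rewrite (Derive_ext p _ s (phase_re_eq g)). apply is_derive_unique.
    auto_derive.
    - repeat split; auto using smooth_ex_derive, smooth_Derive.
    - eta_Derive (re1 g) s. eta_Derive (im1 g) s.
      eta_Derive (re2 g) s. eta_Derive (im2 g) s.
      eta_Derive (Derive (re1 g)) s. eta_Derive (Derive (im1 g)) s.
      eta_Derive (Derive (re2 g)) s. eta_Derive (Derive (im2 g)) s. ring. }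
  assert (Dq : forall s, Derive q s
     = re1 g s * Derive (Derive (im2 g)) s + im1 g s * Derive (Derive (re2 g)) s
       - (re2 g s * Derive (Derive (im1 g)) s + im2 g s * Derive (Derive (re1 g)) s)).
  { intros s. rewrite (Derive_ext q _ s (phase_im_eq g)). apply is_derive_unique.
    auto_derive.
    - repeat split; auto using smooth_ex_derive, smooth_Derive.
    - eta_Derive (re1 g) s. eta_Derive (im1 g) s.
      eta_Derive (re2 g) s. eta_Derive (im2 g) s.
      eta_Derive (Derive (re1 g)) s. eta_Derive (Derive (im1 g)) s.
      eta_Derive (Derive (re2 g)) s. eta_Derive (Derive (im2 g)) s. ring. }
  (* [k = Im (u' * Cconj u)]. *)
  assert (K : forall s, curvature g s = p s * Derive q s - q s * Derive p s).
  { intros s. rewrite curvature_eq, Dp, Dq.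
    destruct (St s) as (Ea & Eb & Ec & Ed & _). rewrite Ea, Eb, Ec, Ed.
    fold (p s) (q s). ring. }
  (* [Re (u' * Cconj u) = 0], from [|u| = 1]. *)
  assert (Tan : forall s, p s * Derive p s + q s * Derive q s = 0).
  { intros s.
    assert (E : is_derive (fun t => p t * p t + q t * q t) s
                  (2 * (p s * Derive p s + q s * Derive q s))).
    { auto_derive; [repeat split; now apply smooth_ex_derive|].
      eta_Derive p s. eta_Derive q s. ring. }
    apply is_derive_unique in E.
    assert (E1 : Derive (fun t => p t * p t + q t * q t) s = 0).
    { rewrite <- (Derive_const 1 s). now apply Derive_ext. }
    pose proof (eq_trans (eq_sym E) E1). lra. }
  split; try assumption.
  - intros s. exact (proj1 (legendrian_equations g s Hg)).
  - intros s. evar_last; [apply smooth_is_derive; assumption | apply St].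
  - intros s. evar_last; [apply smooth_is_derive; assumption | apply St].
  - intros s. evar_last; [apply smooth_is_derive; assumption | apply St].
  - intros s. evar_last; [apply smooth_is_derive; assumption | apply St].
  - intros s. evar_last; [apply smooth_is_derive; assumption |].
    rewrite K. specialize (Unit s). specialize (Tan s).
    transitivity (Derive p s * (p s * p s + q s * q s)
                  - p s * (p s * Derive p s + q s * Derive q s)); [|ring].
    rewrite Unit, Tan. ring.
  - intros s. evar_last; [apply smooth_is_derive; assumption |].
    rewrite K. specialize (Unit s). specialize (Tan s).
    transitivity (Derive q s * (p s * p s + q s * q s)
                  - q s * (p s * Derive p s + q s * Derive q s)); [|ring].
    rewrite Unit, Tan. ring.
Qed.

(** * Geometry of the Clifford projection *)

(** With [z = a + i b], [w = c + i d], [u = p + i q] this is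
    [(|z|^2 - |w|^2, 2 (Cconj z) w)], the value of the Clifford map. *)
Definition frame_point (a b c d : R) : R3 :=
  (a * a + b * b - (c * c + d * d), 2 * (a * c + b * d), 2 * (a * d - b * c)).

(** Half the derivative of [frame_point] under [z' = - u * Cconj w] and
    [w' = u * Cconj z]; its last two coordinates form the complex number
    [u * (Cconj z)^2 - (Cconj u) * w^2]. *)
Definition frame_tangent (a b c d p q : R) : R3 :=
  (- 2 * (p * (a * c - b * d) + q * (a * d + b * c)),
   p * (a * a - b * b - c * c + d * d) + 2 * q * (a * b - c * d),
   q * (a * a - b * b + c * c - d * d) - 2 * p * (a * b + c * d)).

(** [frame_tangent] with [u] replaced by [i u]. *)
Definition frame_normal (a b c d p q : R) : R3 :=
  (2 * (q * (a * c - b * d) - p * (a * d + b * c)),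
   - q * (a * a - b * b - c * c + d * d) + 2 * p * (a * b - c * d),
   p * (a * a - b * b + c * c - d * d) + 2 * q * (a * b + c * d)).

Lemma deriv3_eq (e : R -> R3) (x y z : R -> R) s x' y' z' :
  (forall t, e t = (x t, y t, z t)) ->
  is_derive x s x' -> is_derive y s y' -> is_derive z s z' ->
  deriv3 e s = (x', y', z').
Proof.
  intros E Hx Hy Hz. unfold deriv3.
  rewrite (Derive_ext (fun t => pr1 (e t)) x), (Derive_ext (fun t => pr2 (e t)) y),
    (Derive_ext (fun t => pr3 (e t)) z) by (intros t; now rewrite E).
  now rewrite (is_derive_unique x s x' Hx), (is_derive_unique y s y' Hy),
    (is_derive_unique z s z' Hz).
Qed.

Lemma frame_tangent_unit a b c d p q :
  a * a + b * b + c * c + d * d = 1 -> p * p + q * q = 1 ->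
  dot (frame_tangent a b c d p q) (frame_tangent a b c d p q) = 1.
Proof.
  intros H1 H2. unfold dot, pr1, pr2, pr3; simpl.
  transitivity ((a * a + b * b + c * c + d * d) ^ 2 * (p * p + q * q)); [ring|].
  rewrite H1, H2. ring.
Qed.

Lemma frame_normal_unit a b c d p q :
  a * a + b * b + c * c + d * d = 1 -> p * p + q * q = 1 ->
  dot (frame_normal a b c d p q) (frame_normal a b c d p q) = 1.
Proof.
  intros H1 H2. unfold dot, pr1, pr2, pr3; simpl.
  transitivity ((a * a + b * b + c * c + d * d) ^ 2 * (p * p + q * q)); [ring|].
  rewrite H1, H2. ring.
Qed.

Lemma frame_point_orthogonal_normal a b c d p q :
  dot (frame_point a b c d) (frame_normal a b c d p q) = 0.
Proof. unfold dot, pr1, pr2, pr3; simpl. ring. Qed.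

(** The left side is homogeneous of degree 4 in [(z, w)] and the right side of
    degree 2, so the identity holds after multiplying the right side by
    [|z|^2 + |w|^2 = 1]. *)
Lemma cross_frame_point_tangent a b c d p q :
  a * a + b * b + c * c + d * d = 1 ->
  cross (frame_point a b c d) (frame_tangent a b c d p q)
  = frame_normal a b c d p q.
Proof.
  intros H1. unfold cross, pr1, pr2, pr3; simpl.
  assert (M : forall x, x = (a * a + b * b + c * c + d * d) * x)
    by (intros; rewrite H1; ring).
  repeat apply injective_projections; simpl;
    (etransitivity; [|symmetry; apply M]); ring.
Qed.

(** Differentiates a polynomial expression in the functions of a Frenet system [F]
    and substitutes their derivatives. *)
Ltac frenet_derive F s :=
  lazymatch type of F with frenet_system ?a ?b ?c ?d ?p ?q ?k =>
  auto_derive;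
  [ repeat split; eexists;
    eauto using frenet_a, frenet_b, frenet_c, frenet_d, frenet_p, frenet_q
  | rewrite (is_derive_unique (fun x : R => a x) s _ (frenet_a _ _ _ _ _ _ _ F s)),
      (is_derive_unique (fun x : R => b x) s _ (frenet_b _ _ _ _ _ _ _ F s)),
      (is_derive_unique (fun x : R => c x) s _ (frenet_c _ _ _ _ _ _ _ F s)),
      (is_derive_unique (fun x : R => d x) s _ (frenet_d _ _ _ _ _ _ _ F s)),
      ?(is_derive_unique (fun x : R => p x) s _ (frenet_p _ _ _ _ _ _ _ F s)),
      ?(is_derive_unique (fun x : R => q x) s _ (frenet_q _ _ _ _ _ _ _ F s)) ]
  end.

Lemma deriv3_frame_curve (a b c d p q k : R -> R) (e : R -> R3) s :
  frenet_system a b c d p q k ->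
  (forall t, e t = frame_point (a t) (b t) (c t) (d t)) ->
  deriv3 e s = scal3 2 (frame_tangent (a s) (b s) (c s) (d s) (p s) (q s)).
Proof.
  intros F He.
  eapply deriv3_eq; [exact He | ..]; frenet_derive F s;
    unfold pr1, pr2, pr3; simpl; ring.
Qed.

Lemma speed_frame_curve (a b c d p q k : R -> R) (e : R -> R3) s :
  frenet_system a b c d p q k ->
  (forall t, e t = frame_point (a t) (b t) (c t) (d t)) ->
  speed e s = 2.
Proof.
  intros F He.
  unfold speed, norm3. rewrite (deriv3_frame_curve _ _ _ _ _ _ _ e s F He).
  set (T := frame_tangent _ _ _ _ _ _).
  replace (dot _ _) with (2 * 2 * dot T T)
    by (unfold dot, scal3, pr1, pr2, pr3; simpl; ring).
  unfold T. rewrite frame_tangent_unit, Rmult_1_r by apply F.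
  apply sqrt_square. lra.
Qed.

Lemma unit_tangent_frame_curve (a b c d p q k : R -> R) (e : R -> R3) s :
  frenet_system a b c d p q k ->
  (forall t, e t = frame_point (a t) (b t) (c t) (d t)) ->
  unit_tangent e s = frame_tangent (a s) (b s) (c s) (d s) (p s) (q s).
Proof.
  intros F He.
  unfold unit_tangent.
  rewrite (speed_frame_curve _ _ _ _ _ _ _ e s F He),
    (deriv3_frame_curve _ _ _ _ _ _ _ e s F He).
  unfold scal3, pr1, pr2, pr3. repeat apply injective_projections; simpl; field.
Qed.

(** The equation [T' = k N - 2 eta]. The derivative of [u] contributes [k N], since
    replacing [u] by [i k u] in [T] gives [k N]; the derivatives of [z] and [w]
    contribute [- 2 |u|^2 eta]. *)
Lemma deriv3_unit_tangent_frame_curve (a b c d p q k : R -> R) (e : R -> R3) s :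
  frenet_system a b c d p q k ->
  (forall t, e t = frame_point (a t) (b t) (c t) (d t)) ->
  deriv3 (unit_tangent e) s =
  (k s * pr1 (frame_normal (a s) (b s) (c s) (d s) (p s) (q s)) - 2 * pr1 (e s),
   k s * pr2 (frame_normal (a s) (b s) (c s) (d s) (p s) (q s)) - 2 * pr2 (e s),
   k s * pr3 (frame_normal (a s) (b s) (c s) (d s) (p s) (q s)) - 2 * pr3 (e s)).
Proof.
  intros F He.
  rewrite He. pose proof (frenet_phase _ _ _ _ _ _ _ F s) as H.
  assert (M : forall x, x = (p s * p s + q s * q s) * x)
    by (intros; rewrite H; ring).
  eapply deriv3_eq; [intros t; exact (unit_tangent_frame_curve _ _ _ _ _ _ _ e t F He) | ..];
    frenet_derive F s;
    unfold pr1, pr2, pr3; simpl;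
    (* [M] supplies the factor [|u|^2] of the term [2 eta]. *)
    match goal with |- _ = _ - ?y => rewrite (M y) end; ring.
Qed.

(** The component of [T' = k N - 2 eta] along the unit vector [N], which is
    orthogonal to [eta], is [k]. *)
Lemma geodesic_curvature_frame_curve (a b c d p q k : R -> R) (e : R -> R3) s :
  frenet_system a b c d p q k ->
  (forall t, e t = frame_point (a t) (b t) (c t) (d t)) ->
  geodesic_curvature e s * speed e s = k s.
Proof.
  intros F He.
  unfold geodesic_curvature. rewrite (speed_frame_curve _ _ _ _ _ _ _ e s F He).
  transitivity (dot (deriv3 (unit_tangent e) s) (unit_normal e s)); [field|].
  unfold unit_normal.
  rewrite (unit_tangent_frame_curve _ _ _ _ _ _ _ e s F He),
    (deriv3_unit_tangent_frame_curve _ _ _ _ _ _ _ e s F He), He.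
  rewrite cross_frame_point_tangent by apply F.
  set (N := frame_normal _ _ _ _ _ _).
  transitivity (k s * dot N N - 2 * dot (frame_point (a s) (b s) (c s) (d s)) N).
  { unfold dot, pr1, pr2, pr3; simpl. ring. }
  unfold N. rewrite frame_normal_unit, frame_point_orthogonal_normal by apply F.
  ring.
Qed.

Lemma clifford_projection_eq g s :
  clifford_projection g s = frame_point (re1 g s) (im1 g s) (re2 g s) (im2 g s).
Proof.
  unfold clifford_projection, clifford_map, frame_point, re1, im1, re2, im2, Cmod.
  rewrite !pow2_sqrt by nra.
  destruct (g s) as [[a b] [c d]]. unfold Re, Im, Cmult, Cconj; simpl.
  repeat apply injective_projections; simpl; ring.
Qed.

Lemma speed_clifford g s : unit_speed_legendrian g ->
  speed (clifford_projection g) s = 2.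
Proof.
  intros Hg.
  exact (speed_frame_curve _ _ _ _ _ _ _ _ s (legendrian_frenet g Hg)
           (clifford_projection_eq g)).
Qed.

Lemma geodesic_curvature_clifford g s : unit_speed_legendrian g ->
  geodesic_curvature (clifford_projection g) s * speed (clifford_projection g) s
  = curvature g s.
Proof.
  intros Hg.
  exact (geodesic_curvature_frame_curve _ _ _ _ _ _ _ _ s (legendrian_frenet g Hg)
           (clifford_projection_eq g)).
Qed.

(** * Periods of the Clifford projection *)

Lemma deriv3_periodic (e : R -> R3) l s :
  (forall t, e (t + l) = e t) -> deriv3 e (s + l) = deriv3 e s.
Proof.
  intros P. unfold deriv3.
  rewrite (Derive_periodic (fun t => pr1 (e t))), (Derive_periodic (fun t => pr2 (e t))),
    (Derive_periodic (fun t => pr3 (e t))) by (intros t; now rewrite P).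
  reflexivity.
Qed.

Lemma speed_periodic (e : R -> R3) l s :
  (forall t, e (t + l) = e t) -> speed e (s + l) = speed e s.
Proof. intros P. unfold speed. now rewrite deriv3_periodic. Qed.

Lemma unit_tangent_periodic (e : R -> R3) l s :
  (forall t, e (t + l) = e t) -> unit_tangent e (s + l) = unit_tangent e s.
Proof.
  intros P. unfold unit_tangent. now rewrite deriv3_periodic, speed_periodic.
Qed.

Lemma geodesic_curvature_periodic (e : R -> R3) l s :
  (forall t, e (t + l) = e t) ->
  geodesic_curvature e (s + l) = geodesic_curvature e s.
Proof.
  intros P. unfold geodesic_curvature, unit_normal.
  rewrite P, (speed_periodic e), (unit_tangent_periodic e), deriv3_periodic;
    auto using unit_tangent_periodic.
Qed.

(** The curvature of [g] is an invariant of its Clifford projection, so it has every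
    period of the projection, even if [g] itself does not. *)
Lemma curvature_periodic_of_clifford g l s : unit_speed_legendrian g ->
  (forall t, clifford_projection g (t + l) = clifford_projection g t) ->
  curvature g (s + l) = curvature g s.
Proof.
  intros Hg P. rewrite <- !geodesic_curvature_clifford by assumption.
  now rewrite geodesic_curvature_periodic, speed_periodic.
Qed.

Lemma phase_periodic g L s :
  (forall t, g (t + L) = g t) -> phase g (s + L) = phase g s.
Proof.
  intros P. unfold phase, deriv_C2, deriv_C.
  rewrite (Derive_periodic (fun t => Re (fst (g t)))),
    (Derive_periodic (fun t => Im (fst (g t)))),
    (Derive_periodic (fun t => Re (snd (g t)))),
    (Derive_periodic (fun t => Im (snd (g t)))), P
    by (intros t; now rewrite P).
  reflexivity.
Qed.

(** A nonzero velocity has a nonzero coordinate. *)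
Lemma immersed_periods_bounded_below (e : R -> R3) :
  ex_derive (fun t => pr1 (e t)) 0 -> ex_derive (fun t => pr2 (e t)) 0 ->
  ex_derive (fun t => pr3 (e t)) 0 -> speed e 0 <> 0 ->
  exists delta, 0 < delta /\
    forall T, 0 < T -> (forall s, e (s + T) = e s) -> delta <= T.
Proof.
  intros H1 H2 H3 Hs.
  apply Derive_correct in H1, H2, H3.
  assert (Bound : forall (f : R3 -> R) d, is_derive (fun t => f (e t)) 0 d -> d <> 0 ->
    exists delta, 0 < delta /\
      forall T, 0 < T -> (forall s, e (s + T) = e s) -> delta <= T).
  { intros f d Hf Hd.
    destruct (periods_bounded_below _ _ Hf Hd) as [delta [Hdelta B]].
    exists delta. split; [assumption|]. intros T HT PT.
    apply B; [assumption|]. intros s. now rewrite PT. }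
  destruct (Req_dec (Derive (fun t => pr1 (e t)) 0) 0) as [E1|N];
    [|now apply Bound in H1].
  destruct (Req_dec (Derive (fun t => pr2 (e t)) 0) 0) as [E2|N];
    [|now apply Bound in H2].
  destruct (Req_dec (Derive (fun t => pr3 (e t)) 0) 0) as [E3|N];
    [|now apply Bound in H3].
  exfalso. apply Hs. unfold speed, norm3.
  replace (deriv3 e 0) with (0, 0, 0) by (unfold deriv3; now rewrite E1, E2, E3).
  replace (dot _ _) with 0 by (unfold dot, pr1, pr2, pr3; simpl; ring).
  apply sqrt_0.
Qed.

Lemma clifford_minimal_period g L : closed_unit_speed_legendrian g L ->
  exists l, minimal_period (clifford_projection g) l.
Proof.
  intros [Hg [HL [PL _]]].
  destruct (immersed_periods_bounded_below (clifford_projection g))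
    as [delta [Hdelta B]].
  1-3: eapply ex_derive_ext;
    [intros t; rewrite clifford_projection_eq; reflexivity |];
    destruct (smooth_coordinates g Hg) as (Ha & Hb & Hc & Hd);
    unfold pr1, pr2, pr3; simpl; auto_derive;
    repeat split; now apply smooth_ex_derive.
  - rewrite speed_clifford by assumption. lra.
  - apply (minimal_period_exists (clifford_projection g) L delta);
      try assumption.
    intros s. unfold clifford_projection. now rewrite PL.
Qed.

Lemma clifford_curve_length g l : unit_speed_legendrian g ->
  curve_length (clifford_projection g) l = 2 * l.
Proof.
  intros Hg. unfold curve_length.
  rewrite (RInt_ext _ (fun _ => 2)) by (intros; now apply speed_clifford).
  rewrite RInt_const. unfold scal; simpl. unfold mult; simpl. ring.
Qed.

(** Since the projection has constant speed 2, its length over a period [l] is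
    [2 l], and [2 L = cl * (2 l)] is the same as [L = cl * l]. *)
Lemma clifford_index_period g L l cl : unit_speed_legendrian g ->
  minimal_period (clifford_projection g) l ->
  is_clifford_index g L cl <-> L = IZR (Zpos cl) * l.
Proof.
  intros Hg Hl. split.
  - intros [l' [Hl' E]]. rewrite clifford_curve_length in E by assumption.
    rewrite (minimal_period_unique _ _ _ Hl Hl'). lra.
  - intros E. exists l. split; [assumption|].
    rewrite clifford_curve_length by assumption. lra.
Qed.

Lemma clifford_index_exists_unique g L : closed_unit_speed_legendrian g L ->
  exists! cl : positive, is_clifford_index g L cl.
Proof.
  intros H. destruct (clifford_minimal_period g L H) as [l Hl].
  destruct H as [Hg [HL [PL _]]].
  destruct (period_multiple _ l L Hl HL) as [n Hn].
  { intros s. unfold clifford_projection. now rewrite PL. }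
  exists n. split; [now apply (clifford_index_period g L l)|].
  intros m Hm. apply (clifford_index_period g L l m Hg Hl) in Hm.
  rewrite Hn in Hm. apply Rmult_eq_reg_r in Hm; [|destruct Hl; lra].
  apply eq_IZR in Hm. congruence.
Qed.

(** * Maslov index *)

Lemma legendrian_angle g : unit_speed_legendrian g ->
  exists phi : R -> R,
    (forall s, is_derive phi s (curvature g s)) /\
    (forall s, cis (phi s) = phase g s).
Proof.
  intros Hg. destruct (legendrian_frenet g Hg) as [_ H1 _ _ _ _ Hp Hq].
  destruct (angle_lift _ _ _ H1 Hp Hq) as [phi [H2 H3]].
  { intros s. now apply smooth_continuous, smooth_curvature. }
  exists phi. split; [exact H2|]. intros s. rewrite H3.
  symmetry. apply surjective_pairing.
Qed.

(** [phi] serves both as the angle function and as its own continuous lift. Its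
    increment over [L] is a multiple of [2 * PI] because [phase g] is
    [L]-periodic, and it does not depend on the starting point because [k] is
    [L]-periodic too. *)
Lemma maslov_index_exists g L phi : unit_speed_legendrian g ->
  (forall t, g (t + L) = g t) ->
  (forall s, is_derive phi s (curvature g s)) ->
  (forall s, cis (phi s) = phase g s) ->
  exists mu, is_maslov_index g L mu.
Proof.
  intros Hg PL Hphi Hcis.
  assert (K : forall s, curvature g (s + L) = curvature g s).
  { intros s. apply curvature_periodic_of_clifford; [assumption|].
    intros t. unfold clifford_projection. now rewrite PL. }
  assert (Sphi : smooth phi).
  { apply smooth_of_Derive; [intros s; eexists; apply Hphi|].
    apply (smooth_ext (curvature g)).
    - intros s. symmetry. apply is_derive_unique, Hphi.
    - now apply smooth_curvature. }
  destruct (cis_eq_angle_eq (phi (0 + L)) (phi 0)) as [mu Hmu].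
  { rewrite !Hcis. now apply phase_periodic. }
  rewrite Rplus_0_l in Hmu.
  assert (Shift : forall s, phi (s + L) = phi s + 2 * PI * IZR mu).
  { intros s. rewrite (primitive_shift phi (curvature g)) by assumption. lra. }
  exists mu, phi. repeat split.
  - intros s. exists mu. rewrite Shift. ring.
  - intros s. exists phi. split; [assumption|]. apply filter_forall.
    intros t. exists 0%Z. ring.
  - intros s. rewrite Hcis. now apply deriv_C2_phase.
  - exists phi. repeat split; auto.
    + intros s. now apply smooth_continuous.
    + intros s. exists 0%Z. ring.
Qed.

(** Whatever the angle function of the index, its continuous lift [psi] is an argument
    of [phase g], as [phi] is, so the two have the same increments. *)
Lemma maslov_index_increment g L phi mu : unit_speed_legendrian g ->
  (forall s, is_derive phi s (curvature g s)) ->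
  (forall s, cis (phi s) = phase g s) ->
  is_maslov_index g L mu -> phi L - phi 0 = 2 * PI * IZR mu.
Proof.
  intros Hg Hphi Hcis (theta & _ & Htheta & psi & Cpsi & Apsi & Shift).
  assert (E : psi L - phi L = psi 0 - phi 0).
  { apply continuous_angle_unique; [|assumption|].
    - intros s. apply (ex_derive_continuous (K := R_AbsRing) (V := R_NormedModule)).
      eexists. apply Hphi.
    - intros s. apply cis_eq_angle_eq.
      rewrite <- (angle_eq_cis_eq _ _ (Apsi s)), Hcis.
      symmetry. now apply phase_unique. }
  specialize (Shift 0). rewrite Rplus_0_l in Shift. lra.
Qed.

Theorem proposition2p8 :
  forall (gamma : R -> C2) (L : R),
    closed_unit_speed_legendrian gamma L ->
    (exists! mu : Z, is_maslov_index gamma L mu) /\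
    (forall mu : Z, is_maslov_index gamma L mu ->
       IZR mu = 1 / (2 * PI) * RInt (curvature gamma) 0 L) /\
    (exists n : Z, total_curvature gamma L = IZR n) /\
    (exists l : R, minimal_period (clifford_projection gamma) l) /\
    (exists! cl : positive, is_clifford_index gamma L cl) /\
    (forall (mu : Z) (cl : positive) (l : R),
       is_maslov_index gamma L mu ->
       is_clifford_index gamma L cl ->
       minimal_period (clifford_projection gamma) l ->
       total_geodesic_curvature (clifford_projection gamma) l
         = IZR mu / IZR (Zpos cl)).
Proof.
  intros g L H. pose proof H as [Hg [HL [PL _]]].
  assert (Ppi := PI_RGT_0).
  assert (Ck : forall s, continuous (curvature g) s).
  { intros s. now apply smooth_continuous, smooth_curvature. }
  destruct (legendrian_angle g Hg) as [phi [Hphi Hcis]].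
  destruct (maslov_index_exists g L phi Hg PL Hphi Hcis) as [mu0 Hmu0].
  assert (Value : forall mu, is_maslov_index g L mu ->
            IZR mu = 1 / (2 * PI) * RInt (curvature g) 0 L).
  { intros mu Hmu. rewrite (RInt_primitive phi) by assumption.
    rewrite (maslov_index_increment g L phi mu) by assumption. field. lra. }
  split; [|split; [|split; [|split; [|split]]]].
  - exists mu0. split; [assumption|]. intros mu Hmu.
    apply eq_IZR. now rewrite (Value mu Hmu), (Value mu0 Hmu0).
  - exact Value.
  - exists mu0. rewrite (Value mu0 Hmu0). unfold total_curvature. field. lra.
  - exact (clifford_minimal_period g L H).
  - exact (clifford_index_exists_unique g L H).
  - intros mu cl l Hmu Hcl Hl.
    assert (K : forall s, curvature g (s + l) = curvature g s).
    { intros s. apply curvature_periodic_of_clifford; [assumption|]. apply Hl. }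
    apply (clifford_index_period g L l cl Hg Hl) in Hcl.
    pose proof (maslov_index_increment g L phi mu Hg Hphi Hcis Hmu) as Inc.
    rewrite Hcl, (primitive_shift_multiple phi (curvature g)) in Inc by assumption.
    unfold total_geodesic_curvature.
    rewrite (RInt_ext _ (curvature g))
      by (intros; now apply geodesic_curvature_clifford).
    rewrite (RInt_primitive phi) by assumption.
    assert (0 < IZR (Zpos cl)) by (apply IZR_lt; lia).
    apply Rmult_eq_reg_l with (IZR (Zpos cl) * (2 * PI)); [|nra].
    transitivity (IZR (Zpos cl) * (phi l - phi 0)); [field; lra|].
    rewrite Inc. field. lra.
Qed.
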